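(* Let $c,d>0$ be real, let $g(x)=xF(c,d;c+d;x)$ for $x\in(0,1)$, and let $$Q_g(x,y)=\frac{g(x)+g(y)}{g(x+y-xy)},\qquad x,y\in(0,1).$$ (1) If $cd\le 1$, then $Q_g(x,y)\ge 1$ for all $x,y\in(0,1)$. (2) If $1/c+1/d\le 2$, then $Q_g(x,y)\le 1$ for all $x,y\in(0,1)$.
   Context: $F(a,b;c;x)=\sum_{n=0}^{\infty}\frac{(a,n)(b,n)}{(c,n)}\frac{x^n}{n!}$ for $|x|<1$ is the Gaussian hypergeometric function, where $(a,0)=1$ and $(a,n)=a(a+1)\cdots(a+n-1)$ for $n\ge 1$. Note that $x+y-xy\in(0,1)$ for $x,y\in(0,1)$. *)

(* Defs.v *)
From Stdlib Require Import Reals Factorial.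
From Coquelicot Require Import Coquelicot.
Open Scope R_scope.

(** Rising factorial [(a,n) = a (a+1) ... (a+n-1)], with [(a,0) = 1]. *)
Fixpoint rising (a : R) (n : nat) : R :=
  match n with
  | O => 1
  | S m => rising a m * (a + INR m)
  end.

(** [Series] is total: the value is meaningful only where the series converges,
    in particular for [Rabs x < 1] when [c] is not a non-positive integer. *)
Definition hypergeom (a b c x : R) : R :=
  Series (fun n => rising a n * rising b n / rising c n * (x ^ n / INR (fact n))).

Definition zero_balanced_g (c d x : R) : R := x * hypergeom c d (c + d) x.

Definition Q (g : R -> R) (x y : R) : R := (g x + g y) / g (x + y - x * y).

(* Main.v *)
(** Substituting [x = 1 - exp (- s)] turns [x + y - x * y] into addition, so the two claims
    say that [s |-> g (1 - exp (- s))] is subadditive, resp. superadditive. This follows from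
    monotonicity of its derivative [(1 - x) * g' x]. If [g x = x * sum a_n x^n], the coefficient
    of [x^n] in [(1 - x) * g' x] is [(n + 1) * a_n - n * a_(n-1)], and for the hypergeometric
    coefficients this has the sign of [(c d - 1) (n - 1) + (2 c d - c - d)]. *)
Require Import Defs.
From Stdlib Require Import Reals Factorial Lra.
From Coquelicot Require Import Coquelicot.
Open Scope R_scope.

(** Termwise comparison of powers on [[0, y]]. The sign condition starts at index 1 because the
    constant terms cancel in the difference. *)
Lemma PSeries_increasing (a : nat -> R) (x y : R) :
  (forall n, 0 <= a (S n)) -> Rbar_lt (Rabs y) (CV_radius a) -> 0 <= x <= y ->
  PSeries a x <= PSeries a y.
Proof.
  intros Ha Hy Hxy.
  assert (Hx : Rbar_lt (Rabs x) (CV_radius a)).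
  { apply Rbar_le_lt_trans with (2 := Hy); simpl.
    rewrite !Rabs_pos_eq; lra. }
  apply CV_disk_inside, ex_series_Rabs in Hx.
  apply CV_disk_inside, ex_series_Rabs in Hy.
  apply Rminus_le_0; unfold PSeries.
  rewrite <- Series_minus by assumption.
  (* Zero becomes a series so that [Series_le] applies; the form [0 * 0] lets [Series_scal_l]
     evaluate it. *)
  replace 0 with (Series (fun _ => 0 * 0)) by (rewrite Series_scal_l; ring).
  apply Series_le; [|now apply (ex_series_minus (V := R_NormedModule))].
  intros [|n]; [simpl; lra|split; [lra|]].
  rewrite <- Rmult_minus_distr_l, Rmult_0_l.
  apply Rmult_le_pos; [apply Ha|].
  rewrite <- Rminus_le_0; now apply pow_incr.
Qed.

Lemma one_minus_mul_PSeries (u : nat -> R) (x : R) :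
  Rbar_lt (Rabs x) (CV_radius u) ->
  (1 - x) * PSeries u x = PSeries (PS_minus u (PS_incr_1 u)) x.
Proof.
  intros Hx.
  rewrite PSeries_minus, PSeries_incr_1; [ring|now apply CV_radius_inside|].
  apply CV_radius_inside; now rewrite CV_radius_incr_1.
Qed.

(** Only an inequality: the factor [1 - x] can cancel a singularity at 1 and enlarge the disk. *)
Lemma CV_radius_one_minus_mul (u : nat -> R) :
  Rbar_le (CV_radius u) (CV_radius (PS_minus u (PS_incr_1 u))).
Proof.
  eapply Rbar_le_trans; [|apply (CV_radius_plus u (PS_opp (PS_incr_1 u)))].
  rewrite CV_radius_opp, CV_radius_incr_1.
  destruct (CV_radius u); simpl; trivial.
  rewrite Rmin_left; lra.
Qed.

(** The exponential substitution is avoided: with [g t = t * PSeries a t] and [y] fixed, the mean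
    value theorem shows that [g (t + y - t * y) - g t] is at least as large at [t = x] as at
    [t = 0], where it equals [g y]. The sign of [a] is left free so that opposite coefficients can
    be used for claim (1). *)
Lemma PSeries_superadditive (a : nat -> R) (x y : R) :
  Rbar_le 1 (CV_radius a) ->
  (forall n, INR (S n) * a n <= INR (S (S n)) * a (S n)) ->
  0 < x < 1 -> 0 < y < 1 ->
  x * PSeries a x + y * PSeries a y <= (x + y - x * y) * PSeries a (x + y - x * y).
Proof.
  intros Hr Hmono Hx Hy.
  (* [PSeries b] is [g] and [PSeries u] is its derivative, so [u n = INR (S n) * a n]. *)
  set (b := PS_incr_1 a). set (u := PS_derive b).
  assert (Hin : forall t, 0 <= t < 1 -> Rbar_lt (Rabs t) (CV_radius a)).
  { intros t Ht; apply Rbar_lt_le_trans with (2 := Hr); simpl.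
    rewrite Rabs_pos_eq; lra. }
  assert (Hub : CV_radius u = CV_radius a).
  { unfold u, b; now rewrite CV_radius_derive, CV_radius_incr_1. }
  assert (Hz : forall t, 0 <= t <= x -> 0 <= t <= t + y - t * y /\ t + y - t * y < 1)
    by (intros; nra).
  assert (Hd : forall t, 0 <= t < 1 -> is_derive (PSeries b) t (PSeries u t)).
  { intros t Ht; apply is_derive_PSeries.
    unfold b; rewrite CV_radius_incr_1; auto. }
  (* Monotonicity of [(1 - t) * g' t]: its coefficient at index [S n] is [u (S n) - u n], which is
     nonnegative by [Hmono]. *)
  assert (Hh : forall s t, 0 <= s <= t /\ t < 1 ->
             (1 - s) * PSeries u s <= (1 - t) * PSeries u t).
  { intros s t Hst.
    rewrite !one_minus_mul_PSeries by (rewrite Hub; apply Hin; lra).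
    apply PSeries_increasing; [|eapply Rbar_lt_le_trans; [|apply CV_radius_one_minus_mul]|lra].
    - intros n; change (0 <= INR (S (S n)) * a (S n) + - (INR (S n) * a n)).
      specialize (Hmono n); lra.
    - rewrite Hub; apply Hin; lra. }
  assert (Hphi : forall t, 0 <= t <= x ->
    is_derive (fun t => PSeries b (t + y - t * y) - PSeries b t) t
      ((1 - y) * PSeries u (t + y - t * y) - PSeries u t)).
  { intros t Ht; apply (is_derive_minus (V := R_NormedModule)); [|apply Hd; lra].
    apply (is_derive_comp (V := R_NormedModule) (PSeries b)).
    - apply Hd; specialize (Hz t Ht); lra.
    - auto_derive; [trivial|ring]. }
  destruct (MVT_gen (fun t => PSeries b (t + y - t * y) - PSeries b t) 0 x
    (fun t => (1 - y) * PSeries u (t + y - t * y) - PSeries u t)) as (t & Ht & Heq).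
  { intros t; rewrite Rmin_left, Rmax_right by lra; intros; apply Hphi; lra. }
  { intros t; rewrite Rmin_left, Rmax_right by lra; intros Ht.
    apply derivable_continuous_pt, ex_derive_Reals_0.
    eexists; now apply Hphi. }
  rewrite Rmin_left, Rmax_right in Ht by lra.
  specialize (Hh t (t + y - t * y) (Hz t Ht)).
  (* By this factorization [Hh] becomes the sign of the derivative in [Hphi], multiplied by
     [1 - t > 0]. *)
  replace (1 - (t + y - t * y)) with ((1 - t) * (1 - y)) in Hh by ring.
  assert (0 <= (1 - y) * PSeries u (t + y - t * y) - PSeries u t).
  { apply Rmult_le_reg_l with (1 - t); lra. }
  replace (0 + y - 0 * y) with y in Heq by ring.
  unfold b in Heq; rewrite !PSeries_incr_1 in Heq.
  nra.
Qed.

Definition hypergeom_coeff (a b c : R) (n : nat) : R :=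
  rising a n * rising b n / rising c n / INR (fact n).

Lemma hypergeom_PSeries (a b c x : R) :
  hypergeom a b c x = PSeries (hypergeom_coeff a b c) x.
Proof.
  apply Series_ext; intros n; unfold hypergeom_coeff, Rdiv; ring.
Qed.

Lemma rising_pos (a : R) (n : nat) : 0 < a -> 0 < rising a n.
Proof.
  intros Ha; induction n as [|n IH]; simpl; [lra|].
  apply Rmult_lt_0_compat; [assumption|].
  pose proof (pos_INR n); lra.
Qed.

Lemma hypergeom_coeff_pos (a b c : R) (n : nat) :
  0 < a -> 0 < b -> 0 < c -> 0 < hypergeom_coeff a b c n.
Proof.
  intros Ha Hb Hc; unfold hypergeom_coeff.
  pose proof (INR_fact_lt_0 n).
  repeat apply Rdiv_lt_0_compat; auto.
  now apply Rmult_lt_0_compat; apply rising_pos.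
  now apply rising_pos.
Qed.

Lemma hypergeom_coeff_S (a b c : R) (n : nat) : 0 < c ->
  hypergeom_coeff a b c (S n) =
  hypergeom_coeff a b c n * ((a + INR n) * (b + INR n) / ((c + INR n) * (INR n + 1))).
Proof.
  intros Hc; unfold hypergeom_coeff.
  pose proof (INR_fact_lt_0 n); pose proof (pos_INR n); pose proof (rising_pos c n Hc).
  rewrite fact_simpl, mult_INR, S_INR; simpl rising.
  field; repeat split; lra.
Qed.

Lemma CV_radius_hypergeom (a b c : R) : 0 < a -> 0 < b -> 0 < c ->
  CV_radius (hypergeom_coeff a b c) = 1.
Proof.
  intros Ha Hb Hc.
  rewrite <- Rinv_1.
  apply CV_radius_finite_DAlembert; [|lra|].
  { intros n; apply Rgt_not_eq; now apply hypergeom_coeff_pos. }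
  (* The ratio of consecutive coefficients splits as [(a + n) / (n + 1)] times [(b + n) / (c + n)],
     each of the form [1 + m / (n + k)] and so tending to 1. *)
  apply is_lim_seq_ext with
    (fun n => (1 + (a - 1) * / (INR n + 1)) * (1 + (b - c) * / (INR n + c))).
  { intros n; rewrite hypergeom_coeff_S by assumption.
    pose proof (pos_INR n); pose proof (hypergeom_coeff_pos a b c n Ha Hb Hc).
    rewrite Rabs_pos_eq.
    - field; lra.
    - replace (_ / _) with ((a + INR n) * (b + INR n) / ((c + INR n) * (INR n + 1)))
        by (field; lra).
      apply Rlt_le, Rdiv_lt_0_compat; nra. }
  assert (Hinv : forall k, is_lim_seq (fun n => / (INR n + k)) 0).
  { intros k; replace (Finite 0) with (Rbar_inv p_infty) by reflexivity.
    apply is_lim_seq_inv; [|discriminate].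
    eapply is_lim_seq_plus; [apply is_lim_seq_INR|apply is_lim_seq_const|reflexivity]. }
  assert (Hfac : forall m k, is_lim_seq (fun n => 1 + m * / (INR n + k)) 1).
  { intros m k; replace (Finite 1) with (Finite (1 + m * 0)) by (f_equal; ring).
    apply is_lim_seq_plus'; [apply is_lim_seq_const|].
    apply (is_lim_seq_scal_l _ m 0), Hinv. }
  replace (Finite 1) with (Finite (1 * 1)) by (f_equal; ring).
  now apply is_lim_seq_mult'.
Qed.

(** Over a common denominator the numerator is [(n + 2)(c + n)(d + n) - (n + 1)^2 (c + d + n)]. The
    third parameter [c + d] makes the quadratic terms cancel along with the cubic ones, leaving an
    expression affine in [n]. *)
Lemma hypergeom_coeff_diff (c d : R) (n : nat) : 0 < c -> 0 < d ->
  exists k, 0 < k /\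
    INR (S (S n)) * hypergeom_coeff c d (c + d) (S n) -
      INR (S n) * hypergeom_coeff c d (c + d) n =
    k * ((c * d - 1) * INR n + (2 * (c * d) - (c + d))).
Proof.
  intros Hc Hd; pose proof (pos_INR n).
  exists (hypergeom_coeff c d (c + d) n / ((c + d + INR n) * (INR n + 1))); split.
  - apply Rdiv_lt_0_compat; [apply hypergeom_coeff_pos; lra|nra].
  - rewrite hypergeom_coeff_S, !S_INR by lra.
    field; lra.
Qed.

Lemma hypergeom_pos (a b c x : R) : 0 < a -> 0 < b -> 0 < c -> 0 <= x < 1 ->
  0 < hypergeom a b c x.
Proof.
  intros Ha Hb Hc Hx; rewrite hypergeom_PSeries.
  apply Rlt_le_trans with (PSeries (hypergeom_coeff a b c) 0).
  - rewrite PSeries_0; now apply hypergeom_coeff_pos.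
  - apply PSeries_increasing; [|rewrite CV_radius_hypergeom by assumption|lra].
    + intros n; apply Rlt_le; now apply hypergeom_coeff_pos.
    + simpl; rewrite Rabs_pos_eq; lra.
Qed.

Theorem theorem3p7 (c d : R) (hc : 0 < c) (hd : 0 < d) :
  (c * d <= 1 ->
     forall x y : R, 0 < x < 1 -> 0 < y < 1 ->
       Q (zero_balanced_g c d) x y >= 1) /\
  (1 / c + 1 / d <= 2 ->
     forall x y : R, 0 < x < 1 -> 0 < y < 1 ->
       Q (zero_balanced_g c d) x y <= 1).
Proof.
  assert (Hcd : 0 < c + d) by lra.
  assert (Hpos : forall x y, 0 < x < 1 -> 0 < y < 1 ->
            0 < zero_balanced_g c d (x + y - x * y)).
  { intros x y Hx Hy; unfold zero_balanced_g.
    apply Rmult_lt_0_compat; [nra|apply hypergeom_pos; nra]. }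
  pose proof (CV_radius_hypergeom c d (c + d) hc hd Hcd) as Hrad.
  split; intros H x y Hx Hy; specialize (Hpos x y Hx Hy); unfold Q.
  - apply Rle_ge, Rmult_le_reg_r with (1 := Hpos).
    unfold Rdiv; rewrite Rmult_assoc, Rinv_l by lra.
    unfold zero_balanced_g; rewrite !hypergeom_PSeries.
    (* Subadditivity of [g] is superadditivity of [- g], whose coefficients satisfy the reversed
       monotonicity. *)
    assert (Hopp := PSeries_superadditive (PS_opp (hypergeom_coeff c d (c + d))) x y).
    rewrite !PSeries_opp, CV_radius_opp, Hrad in Hopp.
    cut (forall n, INR (S (S n)) * hypergeom_coeff c d (c + d) (S n) <=
                   INR (S n) * hypergeom_coeff c d (c + d) n).
    { intros Hmono.
      enough (- (x * PSeries (hypergeom_coeff c d (c + d)) x +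
                 y * PSeries (hypergeom_coeff c d (c + d)) y) <=
              - ((x + y - x * y) * PSeries (hypergeom_coeff c d (c + d)) (x + y - x * y)))
        by lra.
      rewrite Ropp_plus_distr, !Ropp_mult_distr_r.
      apply Hopp; [apply Rbar_le_refl| |assumption|assumption].
      intros n; change (INR (S n) * - hypergeom_coeff c d (c + d) n <=
                        INR (S (S n)) * - hypergeom_coeff c d (c + d) (S n)).
      specialize (Hmono n); lra. }
    intros n; destruct (hypergeom_coeff_diff c d n hc hd) as (k & Hk & Heq).
    pose proof (pos_INR n).
    (* [(c + d)^2 >= 4 c d >= (2 c d)^2] when [c d <= 1] *)
    assert (2 * (c * d) <= c + d).
    { apply Rsqr_incr_0_var; [unfold Rsqr|lra].
      assert (0 <= (c - d) * (c - d)) by apply Rle_0_sqr.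
      assert (0 < c * d) by nra.
      nra. }
    (* The affine factor of [Heq] with its sign changed: slope and value at [n = 0] are both
       nonnegative. *)
    assert (0 <= k * ((1 - c * d) * INR n + (c + d - 2 * (c * d)))).
    { apply Rmult_le_pos; [lra|].
      assert (0 <= (1 - c * d) * INR n) by (apply Rmult_le_pos; lra).
      lra. }
    lra.
  - apply Rmult_le_reg_r with (1 := Hpos).
    unfold Rdiv; rewrite Rmult_assoc, Rinv_l by lra.
    unfold zero_balanced_g; rewrite !hypergeom_PSeries.
    rewrite Rmult_1_l, Rmult_1_r.
    apply PSeries_superadditive; [rewrite Hrad; apply Rbar_le_refl| |assumption|assumption].
    intros n; destruct (hypergeom_coeff_diff c d n hc hd) as (k & Hk & Heq).
    pose proof (pos_INR n).
    assert (0 < c * d) by nra.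
    (* Clearing denominators in the hypothesis gives the sign at [n = 0]; the sign of the slope
       [c * d - 1] is then deduced from it. *)
    assert (c + d <= 2 * (c * d)).
    { replace (1 / c + 1 / d) with ((c + d) / (c * d)) in H by (field; lra).
      apply Rmult_le_compat_r with (r := c * d) in H; [|lra].
      replace ((c + d) / (c * d) * (c * d)) with (c + d) in H by (field; lra).
      lra. }
    (* [(2 c d)^2 >= (c + d)^2 >= 4 c d] *)
    assert (1 <= c * d).
    { assert (0 <= (c - d) * (c - d)) by apply Rle_0_sqr.
      assert ((c + d) * (c + d) <= (2 * (c * d)) * (2 * (c * d)))
        by (apply Rmult_le_compat; lra).
      nra. }
    assert (0 <= k * ((c * d - 1) * INR n + (2 * (c * d) - (c + d)))).
    { apply Rmult_le_pos; [lra|].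
      assert (0 <= (c * d - 1) * INR n) by (apply Rmult_le_pos; lra).
      lra. }
    lra.
Qed.
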